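(* Let $\lvert\operatorname{YFrieze}(w)\rvert$ denote the number of $\mathbf{Y}$-frieze patterns of width $w$. Then $$\lvert\operatorname{YFrieze}(w)\rvert=\begin{cases} C^{(2)}_{w+1}, & \text{if } w \text{ is even};\\ C^{(2)}_{w+1}-C^{(3)}_{\frac{w+1}{2}}, & \text{if } w\equiv 1 \pmod 4;\\ C^{(2)}_{w+1}-C^{(3)}_{\frac{w+1}{2}}-C^{(5)}_{\frac{w+1}{4}}, & \text{if } w\equiv 3\pmod 4,\end{cases}$$ where $C^{(q)}_p:=\frac{1}{(q-1)p+1}\binom{qp}{p}$ are the Fuss-Catalan numbers.
   Context: Let $w\in\mathbb{Z}_{\ge -1}$. A $\mathbf{Y}$-frieze pattern $B$ of width $w$ is an integer array $(b_{i,j})_{i,j\in\mathbb{Z},\,-3\le j-i\le w+2}$ such that: (1) for all $i\in\mathbb{Z}$, $b_{i,i-3}=b_{i,i-1}=b_{i,i+w}=b_{i,i+w+2}=0$ and $b_{i,i-2}=b_{i,i+w+1}=-1$; (2) $b_{i,j}$ is a positive integer for all $i,j\in\mathbb{Z}$ with $0\le j-i\le w-1$; (3) ($\mathbf{Y}$-diamond rule) $b_{i,j}b_{i+1,j+1}=(1+b_{i,j+1})(1+b_{i+1,j})$ for all $i,j\in\mathbb{Z}$ with $-2\le j-i\le w+1$. The set of all $\mathbf{Y}$-frieze patterns of width $w$ is denoted by $\operatorname{YFrieze}(w)$.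
   Formalization: The formula is proved for all w ≥ 0; the width w = −1 is excluded because there the printed formula gives 1 − 1 − 1 = −1, whereas exactly one Y-frieze pattern of width −1 exists. *)

(* Defs.v *)
From mathcomp Require Import all_boot all_order all_algebra.
From mathcomp Require Import all_classical.

Set Implicit Arguments.
Unset Strict Implicit.
Unset Printing Implicit Defensive.

Import Order.TTheory GRing.Theory Num.Theory.

Local Open Scope classical_set_scope.
Local Open Scope ring_scope.

(* The index set of an array of width w, for w >= -1.  Arrays are functions on
   this set only, so that two patterns are equal exactly when they have the
   same entries. *)
Definition strip (w : int) : Type :=
  {ij : int * int | - 3 <= ij.2 - ij.1 <= w + 2}.

Definition array (w : int) : Type := strip w -> int.

(* The default value 0 outside the strip is never used in the axioms below:
   they only mention entries whose indices lie in the strip. *)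
Definition entry (w : int) (b : array w) (i j : int) : int :=
  if insub (i, j) is Some s then b s else 0.

Definition boundary_condition (w : int) (b : array w) : Prop :=
  forall i : int,
    [/\ entry b i (i - 3) = 0,
        entry b i (i - 1) = 0,
        entry b i (i + w) = 0 &
        entry b i (i + w + 2) = 0] /\
    (entry b i (i - 2) = - 1 /\ entry b i (i + w + 1) = - 1).

Definition positivity_condition (w : int) (b : array w) : Prop :=
  forall i j : int, 0 <= j - i <= w - 1 -> 0 < entry b i j.

Definition Ydiamond_rule (w : int) (b : array w) : Prop :=
  forall i j : int, - 2 <= j - i <= w + 1 ->
    entry b i j * entry b (i + 1) (j + 1) =
    (1 + entry b i (j + 1)) * (1 + entry b (i + 1) j).

Definition YFrieze (w : int) : set (array w) :=
  [set b | [/\ boundary_condition b, positivity_condition b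
             & Ydiamond_rule b]].
Arguments YFrieze w : clear implicits.

(* For w = -1, which is 3 modulo 4, the alternating count
   C^(2)_0 - C^(3)_0 - C^(5)_0 is -1, whereas there is exactly one pattern of
   width -1; counting formulas are therefore stated for w >= 0. *)
Definition fuss_catalan (q p : nat) : rat :=
  1 / ((q%:R - 1) * p%:R + 1) * 'C(q * p, p)%:R.

(* Main.v *)
(* A triangulation of the (w+3)-gon is a chain of vectors v_0 = (1,0), ...,
   v_(w+2) = (0,1) of Z^2 with det(v_i, v_(i+1)) = 1; extended by
   v_(i+w+3) = - v_i it gives the Y-frieze pattern
     b_(i,j) = det(v_(i-1), v_(j+2)) det(v_i, v_(j+1)).
   Conversely choose positive rationals c_i with c_i c_(i+1) = 1 + b_(i,i).
   Integrality of b forces c_i c_j to be an integer whenever i and j have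
   opposite parity, so that multiplying the even c_i by t and the odd ones by
   1/t makes all of them integers; taking the odd ones coprime makes t unique.
   Hence Y-frieze patterns correspond to the chains for which no g > 1 divides
   the second coordinates of all the even-indexed vectors. Such a g can only be
   2 or 3, and the chains with g = 2 (resp. g = 3) are the dissections of the
   polygon into quadrangles (resp. hexagons). All three families are counted by
   the same recursion on forests of q-ary trees, q = 2, 3, 5. *)
Require Import Defs.
From mathcomp Require Import all_boot all_order all_algebra.
From mathcomp Require Import all_classical.
From mathcomp Require Import zify ring.

Set Implicit Arguments.
Unset Strict Implicit.
Unset Printing Implicit Defensive.

Import Order.TTheory GRing.Theory Num.Theory.

Local Open Scope ring_scope.

(** * Chains of vectors and their refinements *)

Definition det (u v : int * int) : int := u.1 * v.2 - u.2 * v.1.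

Definition comb (u v a : int * int) : int * int :=
  (a.1 * u.1 + a.2 * v.1, a.1 * u.2 + a.2 * v.2).

Lemma det_comb u v a b : det (comb u v a) (comb u v b) = det a b * det u v.
Proof. by rewrite /det /comb /=; ring. Qed.

(** For [g = 1] the divisibility clause is void. For [g > 1] determinant one keeps [g] from dividing
    both second coordinates, so along a chain they are divisible alternately. *)
Definition edge (g : int) (u v : int * int) : bool :=
  (det u v == 1) && ((g %| u.2)%Z || (g %| v.2)%Z).

Definition ccw (u v : int * int) : bool := 0 < det u v.

(** [pairwise ccw] confines the chain to less than a half-turn; unit determinants of neighbours
    alone would let it wind around the origin. *)
Definition chain g t := sorted (edge g) t && pairwise ccw t.

Lemma ccw_irr u : ccw u u = false.
Proof. by rewrite /ccw /det mulrC subrr ltxx. Qed.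

Lemma chain_uniq g t : chain g t -> uniq t.
Proof.
case/andP=> _; rewrite uniq_pairwise; apply: sub_pairwise => u v.
by apply: contraTneq => ->; rewrite ccw_irr.
Qed.

Lemma chain_behead g u t : chain g (u :: t) -> chain g t.
Proof.
by case/andP=> /path_sorted h; rewrite pairwise_cons => /andP[_ h']; apply/andP.
Qed.

(** By Cramer's rule [det w v] and [det u w] are the coordinates of [w] in the basis [(u, v)]. *)
Lemma det_mediant u v w :
  det u v = 1 -> det u w = 1 -> det w v = 1 -> w = u + v.
Proof.
case: u v w => [u1 u2] [v1 v2] [a b]; rewrite /det /= => uv y1 x1.
have ea : a = u1 + v1.
  have: a * (u1 * v2 - u2 * v1) =
    (a * v2 - b * v1) * u1 + (u1 * b - u2 * a) * v1 by ring.
  by rewrite uv x1 y1 => e; lia.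
have eb : b = u2 + v2.
  have: b * (u1 * v2 - u2 * v1) =
    (a * v2 - b * v1) * u2 + (u1 * b - u2 * a) * v2 by ring.
  by rewrite uv x1 y1 => e; lia.
by rewrite ea eb.
Qed.

(** In the basis [(u, v)] the path starts below the diagonal and reaches [v], which lies above it.
    Neighbours on opposite sides would have determinant at least 2, so the path meets the diagonal,
    and there determinant one leaves only [(1, 1)]. *)
Lemma mediant_in_path u v w t :
  det u v = 1 -> path (fun a b => det a b == 1) w t ->
  all (ccw u) t -> pairwise ccw t -> v \in t ->
  0 < det u w < det w v -> u + v \in t.
Proof.
move=> uv; elim: t w => //= w' t IH w /andP[/eqP ww' pt] /andP[uw' ut].
move=> /andP[w't tt] vt /andP[y0 xy].
have x'0 : 0 <= det w' v.
  move: vt; rewrite inE => /predU1P[->|vt].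
    by rewrite /det mulrC subrr.
  by apply: ltW; exact: (allP w't).
have pl : det w v * det u w' - det u w * det w' v = 1.
  rewrite -ww' -[RHS]mulr1 -uv /det; ring.
move: uw'; rewrite /ccw => y'0.
rewrite inE; case: (ltrgtP (det u w') (det w' v)) => c.
- apply/orP; right; apply: (IH w') => //; last by rewrite y'0.
  move: vt; rewrite inE => /predU1P[e|//].
  by move: c y'0; rewrite -e /det [X in _ < X - _]mulrC subrr => *; lia.
- nia.
- apply/orP; left; apply/eqP/esym/det_mediant => //; first by nia.
  by rewrite -c; nia.
Qed.

Lemma mediant_in_chain g u v w p t :
  chain g (p ++ u :: w :: t) -> det u v = 1 -> v \in t ->
  u + v \in p ++ u :: w :: t.
Proof.
rewrite /chain pairwise_cat /= => /andP[/cat_sorted2[_ /= /andP[uw pt]]].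
move=> /and3P[_ _ /and3P[/andP[uw' ut] wt tt]] uv vt.
rewrite mem_cat !inE; apply/orP; right; apply/orP; right.
case/andP: uw => /eqP duw _.
have xw : 0 < det w v by exact: (allP wt).
case: (ltrgtP (det w v) 1) => c; first by lia.
- apply/orP; right; apply: (@mediant_in_path u v w) => //.
    by apply: sub_path pt => a b /andP[].
  by rewrite duw.
- by rewrite (det_mediant uv duw c) eqxx.
Qed.

(** The sign of the determinant puts [u] before [v], and since they do not form an edge they are not
    neighbours. *)
Lemma mediant_mem g t u v :
  chain g t -> u \in t -> v \in t -> det u v = 1 -> ~~ edge g u v ->
  u + v \in t.
Proof.
move=> ct; have := ct; move=> + ut; case/splitPr: ut ct => p r.
move=> ct _ vt uv nuv.
have vr : v \in r.
  move: ct vt => /andP[_]; rewrite pairwise_cat mem_cat inE /=.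
  case/and4P=> /allrelP ur _ _ _ /or3P[vp|/eqP e|//].
    have := ur _ _ vp (mem_head _ _).
    by rewrite /ccw; move: uv; rewrite /det; lia.
  by move: uv; rewrite e /det mulrC subrr.
case: r vr ct {vt} => // w r; rewrite inE => /predU1P[e|vr] ct.
  case/andP: ct => /cat_sorted2[_ /= /andP[h _]] _.
  by rewrite e h in nuv.
exact: mediant_in_chain ct uv vr.
Qed.

(** * Refining a chain by repeated insertion of blocks *)

Section Refinements.
Variables (g : int) (k : nat).
Variable (sigma : int * int -> int * int -> seq (int * int)).
Hypothesis size_sigma : forall u v, size (sigma u v) = k.+1.

(** The first edge is either kept for good, or receives a block and is scanned again from the same
    [u] with one insertion fewer. This fixed order prevents double listing. The nested [fix] lets
    the list grow when [p] decreases. *)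
Fixpoint refinements (p : nat) : seq (int * int) -> seq (seq (int * int)) :=
  fix loop s := match s with
  | [::] => [::]
  | u :: s' => match s' with
    | [::] => if p is 0 then [:: s] else [::]
    | v :: _ => map (cons u) (loop s') ++
        if p is p'.+1 then refinements p' (u :: sigma u v ++ s') else [::]
    end
  end.

Lemma refinements_cons2 p u v s :
  refinements p [:: u, v & s] = map (cons u) (refinements p (v :: s)) ++
    if p is p'.+1 then refinements p' (u :: sigma u v ++ v :: s) else [::].
Proof. by case: p. Qed.

Lemma size_refinements0 u s : size (refinements 0%N (u :: s)) = 1%N.
Proof.
by elim: s u => // v s IH u; rewrite (refinements_cons2 0) cats0 size_map IH.
Qed.

(** With [q = k + 2] and [n = p + 1] this is the number [(r / n) C(q n + r - 1, n - 1)] of forests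
    of [r] q-ary trees with [n] inner nodes. The recursion is
    [N(n, r + 1) = N(n, r) + N(n - 1, r + q)]. *)
Lemma size_refinements p r s : size s = r.+1 ->
  (p.+1 * size (refinements p.+1 s) = r * 'C(k.+2 * p + k.+1 + r, p))%N.
Proof.
elim: p r s => [|p IHp] r s; elim: r s => [|r IHr] [|u [|v s]] // sz;
  rewrite ?muln0 //.
  rewrite (refinements_cons2 1) size_cat size_map mulnDr IHr;
    last by move: sz => /= [->].
  by rewrite size_refinements0 !bin0; lia.
rewrite (refinements_cons2 p.+2) size_cat size_map mulnDr IHr;
    last by move: sz => /= [->].
have sz' : size (u :: sigma u v ++ v :: s) = (r + k.+2).+1.
  by move: sz; rewrite /= size_cat size_sigma /=; lia.
have := IHp _ _ sz'.
set N := size _; set M := (_ + _ + (r + _))%N => e.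
have -> : (k.+2 * p.+1 + k.+1 + r)%N = M by rewrite /M; lia.
have -> : (k.+2 * p.+1 + k.+1 + r.+1)%N = M.+1 by rewrite /M; lia.
rewrite binS; have := mul_bin_left M p.
set d := (M - p)%N; set A := 'C(M, p); set B := 'C(M, p.+1) => eB.
have eM : (d + p)%N = M by rewrite subnK // /M; lia.
(* After multiplication by [p + 1], the relation [(p + 1) B = d A] makes every term a multiple of
   [A]. *)
apply/eqP; rewrite -(eqn_pmul2l (isT : (0 < p.+1)%N)); apply/eqP.
have -> : (p.+1 * (r * B + p.+2 * N) = r * (p.+1 * B) + p.+2 * (p.+1 * N))%N.
  by lia.
have -> : (p.+1 * (r.+1 * (B + A)) = r.+1 * (p.+1 * B + p.+1 * A))%N by lia.
rewrite eB e -/A.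
have -> : (r * (d * A) + p.+2 * ((r + k.+2) * A) =
  (r * d + p.+2 * (r + k.+2)) * A)%N by lia.
have -> : (r.+1 * (d * A + p.+1 * A) = (r.+1 * (d + p.+1)) * A)%N by lia.
congr (_ * _)%N; have : (d = k.+2 * p + k.+1 + (r + k.+2) - p)%N by [].
by move: eM; rewrite /M => eM _; nia.
Qed.

Hypothesis sigma_chain :
  forall u v, edge g u v -> chain g (u :: rcons (sigma u v) v).
Hypothesis sigma_ccwr :
  forall z u v, edge g u v -> ccw z u -> ccw z v -> all (ccw z) (sigma u v).
Hypothesis sigma_ccwl : forall z u v, edge g u v -> ccw u z -> ccw v z ->
  all (ccw^~ z) (sigma u v).

Lemma chain_insert u v s :
  chain g [:: u, v & s] -> chain g (u :: sigma u v ++ v :: s).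
Proof.
case/andP=> /= /andP[uv pt] /and3P[/andP[_ us] vs ss].
case/andP: (sigma_chain uv) => /= pc; rewrite all_rcons pairwise_rcons.
case/and3P=> /andP[cuv us1] sv ps1.
have s1s : allrel ccw (sigma u v) s.
  apply/allrelP => x y xs ys.
  exact: (allP (sigma_ccwl uv (allP us _ ys) (allP vs _ ys))).
apply/andP; split=> /=.
  by move: pc; rewrite -cats1 !cat_path /= => /and3P[-> -> _].
rewrite all_cat us1 /= cuv us pairwise_cat ps1 /= vs ss !andbT.
by rewrite allrel_consr sv.
Qed.

Lemma refinements_ccw z p s t : chain g s -> all (ccw z) s ->
  t \in refinements p s -> all (ccw z) t.
Proof.
elim: p s t => [|p IHp]; elim=> [|u [|v s] IHs] t // cs zs.
- by rewrite inE => /eqP->.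
- rewrite (refinements_cons2 0) cats0 => /mapP[t' t's ->] /=.
  case/andP: zs => -> zs /=.
  exact: IHs (chain_behead cs) zs t's.
- rewrite (refinements_cons2 p.+1) mem_cat => /orP[/mapP[t' t's ->] /=|].
    case/andP: zs => -> zs /=.
    exact: IHs (chain_behead cs) zs t's.
  apply: IHp; first exact: chain_insert.
  case/and3P: zs => zu zv zs; case/andP: cs => /= /andP[uv _] _.
  by rewrite /= zu all_cat sigma_ccwr //= zv.
Qed.

Lemma refinements_sound p u s t : chain g (u :: s) ->
  t \in refinements p (u :: s) ->
  exists t', [/\ t = u :: t', chain g t, {subset s <= t'},
    last u t' = last u s & size t' = (size s + k.+1 * p)%N].
Proof.
(* The case of a kept first edge, shared by [p = 0] and [p > 0]. *)
have skip q v s' t' : (forall u t, chain g (u :: s') ->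
      t \in refinements q (u :: s') ->
      exists t', [/\ t = u :: t', chain g t, {subset s' <= t'},
        last u t' = last u s' & size t' = (size s' + k.+1 * q)%N]) ->
    forall u, chain g [:: u, v & s'] ->
    t' \in refinements q (v :: s') ->
    exists t'', [/\ u :: t' = u :: t'', chain g (u :: t'),
      {subset v :: s' <= t''}, last u t'' = last u (v :: s')
      & size t'' = (size (v :: s') + k.+1 * q)%N].
  move=> IH {}u cs t's; have cs' := chain_behead cs.
  have [t'' [e ct st lt szt]] := IH _ _ cs' t's.
  have uvs : all (ccw u) (v :: s') by case/andP: cs => _ /andP[].
  exists t'; split=> //.
  - case/andP: ct => ct1 ct2; apply/andP; split.
      case/andP: cs => /andP[uv _] _; rewrite e /= uv.
      by rewrite -[path _ _ _]/(sorted (edge g) (v :: t'')) -e.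
    by rewrite pairwise_cons ct2 (refinements_ccw cs' uvs t's).
  - by move=> x; rewrite e !inE => /orP[->//|/st->]; rewrite orbT.
  - by rewrite e.
  - by rewrite e /= szt.
elim: p u s t => [|p IHp] u s; elim: s u => [|v s IHs] u t // cs.
- by rewrite inE => /eqP->; exists [::]; split=> //; rewrite muln0.
- rewrite (refinements_cons2 0) cats0 => /mapP[t' t's ->].
  exact: skip IHs _ cs t's.
- rewrite (refinements_cons2 p.+1) mem_cat => /orP[/mapP[t' t's ->]|ts].
    exact: skip IHs _ cs t's.
  have [t' [-> ct st lt szt]] := IHp _ _ _ (chain_insert cs) ts.
  exists t'; split=> //.
  + by move=> x xs; apply: st; rewrite mem_cat xs orbT.
  + by rewrite lt last_cat.
  + by rewrite szt size_cat size_sigma /=; lia.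
Qed.

Hypothesis sigma_sub : forall u v t, chain g t -> edge g u v ->
  u \in t -> v \in t -> u + v \in t -> {subset sigma u v <= t}.

(** If both chains start with the same edge, drop it. Otherwise [v] comes later in [t], so [t]
    contains the mediant [u + v], hence by [sigma_sub] the whole block; inserting the block in [s]
    shrinks the difference in length. *)
Lemma refinements_complete u s t : chain g (u :: s) -> chain g (u :: t) ->
  {subset s <= t} -> last u t = last u s ->
  exists p, u :: t \in refinements p (u :: s).
Proof.
have [n] := ubnP (size t - size s).
elim: n u s t => // n IHn u s; elim: s u => [|v s IHs] u t nt cs ct st lt.
  exists 0%N; case/lastP: t ct lt {nt st} => [|t x] => [_ _|/chain_uniq].
    by rewrite inE.
  by rewrite last_rcons /= mem_rcons inE => /andP[+ _] e; rewrite e eqxx.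
case: t nt ct st lt => [|w t] nt ct st lt.
  by have := st _ (mem_head _ _).
have [vw|vw] := eqVneq v w.
  rewrite -vw in ct st lt *.
  have st' : {subset s <= t}.
    move=> x xs; have := st x.
    rewrite !inE xs orbT => /(_ isT) /predU1P[xv|//].
    by have /chain_uniq := chain_behead cs; rewrite /= -xv xs.
  have [p tp] := IHs v t nt (chain_behead cs) (chain_behead ct) st' lt.
  by exists p; rewrite refinements_cons2 mem_cat map_f.
have ct0 := ct; case/andP: (cs) => /andP[uv _] _.
have vt : v \in t by have := st _ (mem_head _ _); rewrite inE (negPf vw).
case/andP: (uv) => /eqP duv _.
have mt := mediant_in_chain (p := [::]) ct duv vt.
have st' : {subset sigma u v ++ v :: s <= w :: t}.
  move=> x; rewrite mem_cat => /orP[xs|]; last exact: st.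
  have := sigma_sub ct uv (mem_head _ _) _ mt xs.
  rewrite inE (st v (mem_head _ _)) orbT => /(_ isT).
  rewrite inE => /predU1P[xu|//].
  case/andP: (chain_uniq (sigma_chain uv)).
  by rewrite xu in xs; rewrite mem_rcons inE xs orbT.
have cs' := chain_insert cs.
have sz := uniq_leq_size (chain_uniq (chain_behead cs')) st'.
have [||p tp] := IHn u (sigma u v ++ v :: s) (w :: t) _ cs' ct st'.
- by move: sz nt; rewrite size_cat size_sigma /=; lia.
- by rewrite last_cat.
by exists p.+1; rewrite (refinements_cons2 p.+1) mem_cat tp orbT.
Qed.

(** If the first edge is kept, [v] comes right after [u]; if it is subdivided, the first block
    vector comes before [v]. A common result would contain these two vectors in both orders. *)
Lemma refinements_uniq p s : chain g s -> uniq (refinements p s).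
Proof.
elim: p s => [|p IHp]; elim=> [|u [|v s] IHs] // cs.
  rewrite (refinements_cons2 0) cats0 map_inj_uniq; last by move=> ? ? [].
  exact: IHs (chain_behead cs).
rewrite (refinements_cons2 p.+1) cat_uniq map_inj_uniq; last by move=> ? ? [].
rewrite IHs ?(chain_behead cs) // IHp ?chain_insert // andbT.
apply/hasPn => t ts; apply/mapP => -[t' t's et].
have [t'' [e + _ _ _]] := refinements_sound (chain_behead cs) t's.
have [t0 [e0 ct st _ _]] := refinements_sound (chain_insert cs) ts.
move=> _; case/andP: (cs) => /andP[uv _] _.
have := size_sigma u v; have := sigma_chain uv.
case es: (sigma u v) st => [|x r] //= st cuv _.
have {}st : x \in t0 by apply: st; rewrite mem_head.
move: et; rewrite e0 e => -[et]; rewrite e0 et in ct; rewrite et in st.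
case/andP: cuv => _ /= /and3P[_ + _]; rewrite all_rcons => /andP[xv _].
move: st; rewrite inE => /predU1P[exv|xt].
  by move: xv; rewrite exv ccw_irr.
case/andP: ct => _ /and3P[_ vt _].
have := allP vt _ xt; move: xv; rewrite /ccw /det; lia.
Qed.
End Refinements.

(* The interior vertices of the (g = 1) triangle, (g = 2) quadrangle or (g = 3)
   hexagon that sits on the edge (u, v), in the basis (u, v), for g dividing the
   second coordinate of u (left) or of v. Its diagonals join the vertices whose
   second coordinate is not divisible by g. *)
Definition cell (g : int) (left : bool) : seq (int * int) :=
  if g == 2 then if left then [:: (1, 1); (1, 2)] else [:: (2, 1); (1, 1)]
  else if g == 3 then
    if left then [:: (1, 1); (2, 3); (1, 2); (1, 3)]
    else [:: (3, 1); (2, 1); (3, 2); (1, 1)]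
  else [:: (1, 1)].

(** The number [q] of sides of the cell besides the edge it sits on, which is the arity of the trees
    to be counted; the cell has [q - 1] interior vertices. *)
Definition cell_arity (g : int) : nat :=
  if g == 2 then 3 else if g == 3 then 5 else 2.

Definition subdivide g (u v : int * int) : seq (int * int) :=
  map (comb u v) (cell g (g %| u.2)%Z).

Lemma comb10 u v : comb u v (1, 0) = u.
Proof. by case: u v => [? ?] [? ?]; rewrite /comb /= !mul1r !mul0r !addr0. Qed.

Lemma comb01 u v : comb u v (0, 1) = v.
Proof. by case: u v => [? ?] [? ?]; rewrite /comb /= !mul1r !mul0r !add0r. Qed.

Lemma comb11 u v : comb u v (1, 1) = u + v.
Proof. by case: u v => [? ?] [? ?]; rewrite /comb /= !mul1r. Qed.

(** A base change of determinant one reduces the chain condition to numerals; [f] selects the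
    coordinate that controls divisibility of the second entry. *)
Lemma map_comb_chain g u v (f : int * int -> int) s :
  det u v = 1 -> (forall a, (g %| f a)%Z -> (g %| (comb u v a).2)%Z) ->
  sorted (fun a b => (det a b == 1) && ((g %| f a)%Z || (g %| f b)%Z)) s ->
  pairwise ccw s -> chain g (map (comb u v) s).
Proof.
move=> uv fP so pw; apply/andP; split; last first.
  rewrite pairwise_map; apply: sub_pairwise pw => a b.
  change (ccw a b -> ccw (comb u v a) (comb u v b)).
  by rewrite /ccw det_comb uv mulr1.
rewrite sorted_map; apply: sub_sorted so => a b /andP[ab /orP fab].
change (edge g (comb u v a) (comb u v b)).
rewrite /edge det_comb uv mulr1 ab.
by case: fab => /fP->; rewrite ?orbT.
Qed.

Lemma cell_gt0 g l a : a \in cell g l -> 0 < a.1 /\ 0 < a.2.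
Proof.
have h : all (fun a => (0 < a.1) && (0 < a.2)) (cell g l).
  by rewrite /cell; case: l; do 2 case: ifP => // _.
by move/(allP h)/andP.
Qed.

Lemma det1_ndvd g u v : det u v = 1 -> g != 1 -> 0 <= g ->
  (g %| u.2)%Z -> ~~ (g %| v.2)%Z.
Proof.
move=> uv g1 g0 gu; apply/negP => gv.
have : (g %| det u v)%Z by rewrite rpredB ?(dvdz_mull _ gv) ?(dvdz_mulr _ gu).
by rewrite uv dvdz1; move: g1 g0; lia.
Qed.

(** * The cells are admissible blocks *)

Section Subdivide.
Variable g : int.
Hypothesis g123 : [|| g == 1, g == 2 | g == 3].

Lemma size_subdivide u v : size (subdivide g u v) =
  (cell_arity g).-2.+1.
Proof.
rewrite /subdivide size_map /cell /cell_arity.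
by case: (_ %| _)%Z; do 2 case: ifP => // _.
Qed.

Lemma subdivide_chain u v :
  edge g u v -> chain g (u :: rcons (subdivide g u v) v).
Proof.
case/andP => /eqP uv guv.
have -> : u :: rcons (subdivide g u v) v =
    map (comb u v) ((1, 0) :: rcons (cell g (g %| u.2)%Z) (0, 1)).
  by rewrite /= map_rcons comb10 comb01.
case: (boolP (g %| u.2)%Z) guv => [gu _|gu]; last rewrite orFb => gv.
  apply: (@map_comb_chain _ _ _ snd) => //.
  - by move=> a ga; rewrite rpredD //  ?(dvdz_mull _ gu) ?(dvdz_mulr _ ga).
  - by case/or3P: g123 => /eqP->.
  - by case/or3P: g123 => /eqP->.
apply: (@map_comb_chain _ _ _ fst) => //.
- by move=> a ga; rewrite rpredD //  ?(dvdz_mull _ gv) ?(dvdz_mulr _ ga).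
- by case/or3P: g123 gu => /eqP->; rewrite ?dvd1z.
- by case/or3P: g123 => /eqP->.
Qed.

Lemma subdivide_ccwr z u v : edge g u v -> ccw z u -> ccw z v ->
  all (ccw z) (subdivide g u v).
Proof.
move=> _ zu zv; apply/allP => _ /mapP[a /cell_gt0[a1 a2] ->].
have -> // : ccw z (comb u v a) = (0 < a.1 * det z u + a.2 * det z v).
  by rewrite /ccw /det /comb /=; congr (_ < _); ring.
by rewrite addr_gt0 // mulr_gt0.
Qed.

Lemma subdivide_ccwl z u v : edge g u v -> ccw u z -> ccw v z ->
  all (ccw^~ z) (subdivide g u v).
Proof.
move=> _ zu zv; apply/allP => _ /mapP[a /cell_gt0[a1 a2] ->].
have -> // : ccw (comb u v a) z = (0 < a.1 * det u z + a.2 * det v z).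
  by rewrite /ccw /det /comb /=; congr (_ < _); ring.
by rewrite addr_gt0 // mulr_gt0.
Qed.

(** A pair of determinant one with neither second coordinate divisible by [g] is a diagonal, not an
    edge, so its mediant lies in [t]. Starting from [u + v], such mediants produce all vertices of
    the cell. *)
Lemma subdivide_sub u v t : chain g t -> edge g u v ->
  u \in t -> v \in t -> u + v \in t -> {subset subdivide g u v <= t}.
Proof.
move=> ct /andP[/eqP duv guv] ut vt uvt.
have med a b c : comb u v a \in t -> comb u v b \in t -> det a b = 1 ->
    ~~ (g %| (comb u v a).2)%Z -> ~~ (g %| (comb u v b).2)%Z ->
    (a.1 + b.1, a.2 + b.2) = c -> comb u v c \in t.
  move=> at_ bt ab ga gb <-.
  have -> : comb u v (a.1 + b.1, a.2 + b.2) = comb u v a + comb u v b.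
    change (comb u v (a.1 + b.1, a.2 + b.2) =
      ((comb u v a).1 + (comb u v b).1, (comb u v a).2 + (comb u v b).2)).
    by rewrite /comb; congr (_, _) => /=; ring.
  apply: mediant_mem ct at_ bt _ _; first by rewrite det_comb ab duv.
  by rewrite /edge negb_and negb_or ga gb orbT.
rewrite -(comb10 u v) in ut; rewrite -(comb01 u v) in vt.
rewrite -(comb11 u v) in uvt.
suff: all (fun a => comb u v a \in t) (cell g (g %| u.2)%Z).
  by move=> h _ /mapP[a /(allP h) ? ->].
have nguv : g != 1 -> 0 <= g -> ~~ ((g %| u.2)%Z && (g %| v.2)%Z).
  by move=> g1 g0; rewrite negb_and -implybE; apply/implyP/det1_ndvd.
rewrite /cell; case/or3P: g123 guv nguv med => /eqP->; rewrite /= ?andbT //.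
- case: ifP => gu guv /(_ isT isT) nguv med; rewrite /= uvt !andbT.
    apply: (med (1, 1) (0, 1)) => //; rewrite /comb /=; move: gu guv nguv; lia.
  apply: (med (1, 0) (1, 1)) => //; rewrite /comb /=; move: gu guv nguv; lia.
case: ifP => gu guv /(_ isT isT) nguv med; rewrite /= uvt ?andbT /=.
  have v12 : comb u v (1, 2) \in t.
    apply: (med (1, 1) (0, 1)) => //; rewrite /comb /=;
      by move: gu guv nguv; lia.
  rewrite v12 /=; apply/andP; split.
    apply: (med (1, 1) (1, 2)) => //; rewrite /comb /=;
      by move: gu guv nguv; lia.
  apply: (med (1, 2) (0, 1)) => //; rewrite /comb /=;
    by move: gu guv nguv; lia.
have v21 : comb u v (2, 1) \in t.
  apply: (med (1, 0) (1, 1)) => //; rewrite /comb /=;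
    by move: gu guv nguv; lia.
rewrite v21 /=; apply/andP; split.
  apply: (med (1, 0) (2, 1)) => //; rewrite /comb /=;
    by move: gu guv nguv; lia.
by apply: (med (2, 1) (1, 1)) => //; rewrite /comb /=; move: gu guv nguv; lia.
Qed.
End Subdivide.

(** * Continuants *)

Section Continuant.
Variables (R : comRingType) (c : nat -> R).

(** The signed continuant of [c_i, ..., c_(i+l-1)]: the determinant of the tridiagonal matrix with
    these on the diagonal and ones beside it. *)
Fixpoint continuant (i l : nat) : R :=
  match l with
  | 0 => 1
  | l1.+1 => match l1 with
    | 0 => c i
    | l2.+1 => c (i + l1)%N * continuant i l1 - continuant i l2
    end
  end.

Lemma continuantSr i l : continuant i l.+2 =
  c (i + l.+1)%N * continuant i l.+1 - continuant i l.
Proof. by []. Qed.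

Lemma continuantSl i l : continuant i l.+2 =
  c i * continuant i.+1 l.+1 - continuant i.+2 l.
Proof.
suff: continuant i l.+2 = c i * continuant i.+1 l.+1 - continuant i.+2 l /\
  continuant i l.+3 = c i * continuant i.+1 l.+2 - continuant i.+2 l.+1.
  by case.
elim: l => [|l [IH1 IH2]].
  by rewrite /= !(addn1, addn2); split; ring.
split=> //; rewrite (continuantSr i) IH2 IH1 (continuantSr i.+1 l.+1).
by rewrite (continuantSr i.+2 l) !addSnnS; ring.
Qed.

(** The diamond rule of Coxeter friezes: by the recurrence, the difference of the two products does
    not change with [l]. *)
Lemma continuant_diamond i l :
  continuant i l.+1 * continuant i.+1 l.+1 =
  1 + continuant i l.+2 * continuant i.+1 l.
Proof.
elim: l => [|l IH]; first by rewrite /= addn1; ring.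
rewrite (continuantSr i.+1 l) (continuantSr i l.+1) addSnnS.
have -> : 1 = continuant i l.+1 * continuant i.+1 l.+1 -
    continuant i l.+2 * continuant i.+1 l by rewrite IH; ring.
ring.
Qed.

End Continuant.

(** * Integrality of products of opposite parity *)

Section Integrality.
Variables (c : nat -> rat).
Local Notation K := (continuant c).

(** Expansion from the right writes an odd continuant as an alternating sum of terms
    [c (i + 2r) * K i (2r)]. *)
Lemma oddcont_int z i s :
  (forall r, (r <= s)%N -> z * c (i + r.*2)%N \is a Num.int) ->
  (forall r, (r <= s)%N -> K i r.*2 \is a Num.int) ->
  z * K i s.*2.+1 \is a Num.int.
Proof.
elim: s => [|s IH] zc Ki; first by have := zc 0%N isT; rewrite addn0.
rewrite doubleS continuantSr mulrBr rpredB //.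
  by rewrite mulrA rpredM //; [exact: (zc s.+1)|exact: (Ki s.+1)].
by apply: IH => r rs; [apply: zc|apply: Ki]; apply: leqW.
Qed.

(** An even continuant is an integer polynomial in products of two of its [c] with indices of
    opposite parity. *)
Lemma evencont_int i s :
  (forall p q, (i <= p < q)%N -> (q < i + s.*2)%N -> odd (p + q) ->
     c p * c q \is a Num.int) ->
  K i s.*2 \is a Num.int.
Proof.
elim: s {-2}s (leqnn s) => [|m IH] [|s] //.
rewrite ltnS => sm cc.
have Kr r : (r <= s)%N -> K i r.*2 \is a Num.int.
  by move=> rs; apply: IH => [|p q ipq qr]; [lia|apply: cc => //; lia].
rewrite doubleS continuantSr rpredB ?Kr //.
apply: oddcont_int Kr => r rs; rewrite mulrC; apply: cc; lia.
Qed.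

(* With x = c_i c_(i+2s+1) and k = K (i+1) (2s), the hypothesis says that x k^2
   is an integer, while x k = x or - x modulo integers. *)
Lemma mul_entries_int L :
  (forall i l, (l <= L)%N -> K i l.+2 * K i.+1 l \is a Num.int) ->
  forall s i, (s.*2 <= L)%N -> c i * c (i + s.*2.+1)%N \is a Num.int.
Proof.
move=> KK; elim/ltn_ind => s IH i sL.
have cc p q : (p < q)%N -> (q - p < s.*2.+1)%N -> odd (p + q) ->
    c p * c q \is a Num.int.
  move=> pq dpq opq; have -> : q = (p + ((q - p)./2).*2.+1)%N by lia.
  by apply: IH; lia.
set x := c i * _; set k := K i.+1 s.*2.
have kZ : k \is a Num.int by apply: evencont_int => p q *; apply: cc; lia.
have evZ j r : (r <= s)%N -> K j r.*2 \is a Num.int.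
  by move=> rs; apply: evencont_int => p q *; apply: cc; lia.
(* Modulo integers, lengthening the continuant by two changes the sign of [x * K i.+1 r.*2]. *)
have xk r : (r <= s)%N -> x * (K i.+1 r.*2 - (-1) ^+ r) \is a Num.int.
  elim: r => [|r IHr] rs; first by rewrite /= subrr mulr0.
  rewrite doubleS continuantSr exprS.
  have -> : x * (c (i.+1 + r.*2.+1)%N * K i.+1 r.*2.+1 - K i.+1 r.*2 -
       -1 * (-1) ^+ r) =
     (c i * K i.+1 r.*2.+1) * (c (i.+1 + r.*2.+1)%N * c (i + s.*2.+1)%N)
     - x * (K i.+1 r.*2 - (-1) ^+ r) by rewrite /x; ring.
  rewrite rpredB ?IHr ?(ltnW rs) // rpredM //; last by apply: cc; lia.
  apply: oddcont_int => r' r'r; last by apply: evZ; lia.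
  by apply: cc; lia.
(* Expansion from the left replaces [K i s.*2.+1] by [c i * k], at the cost of an integer; this
   turns [KK] into integrality of [x k^2]. *)
have xkB : c (i + s.*2.+1)%N * K i s.*2.+1 - x * k \is a Num.int.
  have [s0|s_gt0] := posnP s.
    have -> // : c (i + s.*2.+1)%N * K i s.*2.+1 - x * k = 0.
    by rewrite /x /k s0 /=; ring.
  have -> : K i s.*2.+1 = c i * k - K i.+2 s.-1.*2.+1.
    by rewrite /k -(prednK s_gt0) doubleS continuantSl.
  have -> : c (i + s.*2.+1)%N * (c i * k - K i.+2 s.-1.*2.+1) - x * k =
      - (c (i + s.*2.+1)%N * K i.+2 s.-1.*2.+1) by rewrite /x; ring.
  rewrite rpredN; apply: oddcont_int => r rs; last by apply: evZ; lia.
  by rewrite mulrC; apply: cc; lia.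
have xkk : x * k * k \is a Num.int.
  have := KK i _ sL; rewrite continuantSr -/k.
  have -> : (c (i + s.*2.+1)%N * K i s.*2.+1 - K i s.*2) * k =
    (c (i + s.*2.+1)%N * K i s.*2.+1 - x * k) * k - K i s.*2 * k
      + x * k * k by ring.
  by rewrite rpredDl // rpredB // rpredM // evZ.
have {}xk := xk s (leqnn s); rewrite -/k in xk.
have sg : ((-1) ^+ s : rat) \is a Num.int by rewrite rpredX // rpredN.
have sg2 : (-1) ^+ s * (-1) ^+ s = 1 :> rat by rewrite -expr2 sqrr_sign.
have -> : x = x * k * k - (x * (k - (-1) ^+ s)) * (k + (-1) ^+ s).
  by transitivity (x * ((-1) ^+ s * (-1) ^+ s)); [rewrite sg2 mulr1|ring].
by rewrite rpredB // rpredM // rpredD.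
Qed.
End Integrality.

Lemma mul_int_den (x : rat) (m : int) :
  (x * m%:~R \is a Num.int) = (denq x %| m)%Z.
Proof.
apply/idP/idP => [/intrP[z ez]|/dvdzP[z ->]].
  have : (numq x * m) = z * denq x.
    apply: (@intr_inj rat); rewrite !rmorphM /= -ez -{2}(divq_num_den x).
    by field; rewrite intr_eq0 denq_eq0.
  move=> e; rewrite -(@Gauss_dvdzr _ (numq x)) ?e ?dvdz_mull //.
  by rewrite /coprimez gcdzC -/(coprimez _ _); exact: coprime_num_den.
apply/intrP; exists (numq x * z); rewrite !rmorphM /= -{1}(divq_num_den x).
by field; rewrite intr_eq0 denq_eq0.
Qed.

(** As [c 0 = 1], the odd-indexed [c q] are integers up to [M]. Divide them by their gcd [G] and
    multiply the even-indexed ones by [G]: the denominator of an even-indexed term divides every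
    odd-indexed [c q], hence [G]. *)
Lemma rescale_int (c : nat -> rat) M : (0 < M)%N ->
  c 0%N = 1 -> (forall i, 0 < c i) ->
  (forall p q, (p < q <= M)%N -> odd (p + q) -> c p * c q \is a Num.int) ->
  exists c' : nat -> rat, [/\ forall i, 0 < c' i,
    forall i, c' i * c' i.+1 = c i * c i.+1,
    forall i, (i <= M)%N -> c' i \is a Num.int
    & forall g : nat, (forall i, (i <= M)%N -> odd i ->
        exists m : int, c' i = (m * g)%:~R) -> g = 1%N].
Proof.
move=> M_gt0 c0 c_gt0 cc.
have c_odd q : (q <= M)%N -> odd q -> c q = (numq (c q))%:~R.
  move=> qM oq; rewrite numqK // -[c q]mul1r -c0 cc //.
  by rewrite qM andbT; case: q oq {qM}.
pose G := \big[gcdn/0%N]_(i < M.+1 | odd i) `|numq (c i)|%N.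
have G_dvd q : (q <= M)%N -> odd q -> (G %| `|numq (c q)|)%N.
  move=> qM oq; exact: (@biggcdn_inf _ (Ordinal (qM : (q < M.+1)%N))).
have G_gt0 : (0 < G)%N.
  have := G_dvd 1%N M_gt0 isT; rewrite lt0n; apply: contraL => /eqP->.
  by rewrite dvd0n absz_eq0 numq_eq0 gt_eqF.
have GQ : 0 < G%:R :> rat by rewrite ltr0n.
exists (fun i => if odd i then c i / G%:R else c i * G%:R); split.
- by move=> i; case: ifP => _; rewrite ?divr_gt0 ?mulr_gt0.
- by move=> i /=; case: ifP => _ /=; field; rewrite gt_eqF.
- move=> i iM; case: ifPn => oi.
    rewrite (c_odd i) // -[G%:R]/(G%:Z%:~R); apply: Qint_dvdz.
    by rewrite dvdzE; exact: G_dvd.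
  rewrite -[G%:R]/(G%:Z%:~R) mul_int_den dvdzE; apply/dvdn_biggcdP => q oq.
  have qM : (q <= M)%N by rewrite -ltnS.
  rewrite -dvdzE -mul_int_den -c_odd //.
  by case: (ltngtP i q) => [iq|qi|e]; [|rewrite mulrC|]; try apply: cc; lia.
move=> g gP.
(* A common divisor [g] left after rescaling would make [g G] a common divisor before it. *)
have : (g * G %| G)%N.
  apply/dvdn_biggcdP => q oq.
  have qM : (q <= M)%N by rewrite -ltnS.
  have [m] := gP q qM oq; rewrite oq (c_odd q) // => e.
  have -> : numq (c q) = m * (g * G)%N.
    apply: (@intr_inj rat); rewrite PoszM mulrA intrM -e mulfVK //.
    by rewrite gt_eqF.
  by rewrite numq_int abszM dvdn_mull.
by rewrite -{2}(mul1n G) dvdn_pmul2r // dvdn1 => /eqP.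
Qed.

(** * Divisibility along a chain *)

Definition pt (t : seq (int * int)) (i : nat) : int * int := nth (0, 0) t i.
Arguments pt : simpl never.

Definition diagonal_path k t :=
  [&& chain 1 t, size t == k.+3, pt t 0%N == (1, 0) & pt t k.+2 == (0, 1)].

Section Path.
Variables (k : nat) (t : seq (int * int)).
Hypothesis t_path : diagonal_path k t.

Lemma path_size : size t = k.+3.
Proof. by case/and4P: t_path => _ /eqP. Qed.

Lemma path_first : pt t 0%N = (1, 0).
Proof. by case/and4P: t_path => _ _ /eqP. Qed.

Lemma path_last : pt t k.+2 = (0, 1).
Proof. by case/and4P: t_path => _ _ _ /eqP. Qed.

Lemma path_det1 i : (i < k.+2)%N -> det (pt t i) (pt t i.+1) = 1.
Proof.
move=> ik; case/and4P: t_path => /andP[st _] /eqP sz _ _.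
have /andP[/eqP//] : edge 1 (pt t i) (pt t i.+1).
by apply: (sortedP (0, 0) st); rewrite sz.
Qed.

Lemma path_ccw i j : (i < j < k.+3)%N -> 0 < det (pt t i) (pt t j).
Proof.
move=> /andP[ij jk]; case/and4P: t_path => /andP[_ st] /eqP sz _ _.
by apply: (pairwiseP (0, 0) st); rewrite ?inE ?sz //; apply: ltn_trans jk.
Qed.

Lemma path_snd_gt0 i : (0 < i < k.+3)%N -> 0 < (pt t i).2.
Proof. by move/path_ccw; rewrite path_first /det mul1r mul0r subr0. Qed.

Lemma path_fst_gt0 i : (i < k.+2)%N -> 0 < (pt t i).1.
Proof.
move=> ik; have := @path_ccw i k.+2; rewrite ik ltnSn => /(_ isT).
by rewrite path_last /det mulr1 mulr0 subr0.
Qed.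

(** This is [det(v_i, v_(i+2)) v_(i+1) = v_i + v_(i+2)], the linear relation among three plane
    vectors whose neighbouring determinants are one. *)
Lemma path_rec i : (i < k.+1)%N ->
  (det (pt t i) (pt t i.+2) * (pt t i.+1).1 = (pt t i).1 + (pt t i.+2).1) *
  (det (pt t i) (pt t i.+2) * (pt t i.+1).2 = (pt t i).2 + (pt t i.+2).2).
Proof.
move=> ik; have d1 := path_det1 (ltnW ik : (i < k.+2)%N).
have d2 : det (pt t i.+1) (pt t i.+2) = 1 by apply: path_det1.
set a := pt t i in d1 *; set b := pt t i.+1 in d1 d2 *.
set c := pt t i.+2 in d2 *; split.
  transitivity (det b c * a.1 + det a b * c.1); first by rewrite /det; ring.
  by rewrite d1 d2 !mul1r.
transitivity (det b c * a.2 + det a b * c.2); first by rewrite /det; ring.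
by rewrite d1 d2 !mul1r.
Qed.

Definition even_dvd (g : nat) :=
  forall i, (i < k.+3)%N -> ~~ odd i -> (g %| (pt t i).2)%Z.

Lemma even_dvd_det g i : even_dvd g -> (i < k.+1)%N -> ~~ odd i ->
  (g %| det (pt t i) (pt t i.+2))%Z.
Proof.
move=> gt ik oi; apply: rpredB.
  by apply: dvdz_mull; apply: gt; lia.
by apply: dvdz_mulr; apply: gt; lia.
Qed.

(** The second coordinate of [v_0] is 0. If [g] divides that of an even-indexed vector, determinant
    one excludes the next vector, and the edge after it forces divisibility two places on. *)
Lemma even_dvd_sorted g : (1 < g)%N -> reflect (even_dvd g) (sorted (edge g) t).
Proof.
move=> g1; apply: (iffP idP) => [st|gt].
  have H i : (i.*2.+2 < k.+4.+1)%N -> (g %| (pt t i.*2).2)%Z.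
    elim: i => [_|i IH ik]; first by rewrite path_first dvdz0.
    rewrite doubleS in ik *.
    have gi := IH (ltnW (ltnW ik)).
    have : edge g (pt t i.*2.+1) (pt t i.*2.+2).
      by apply: (sortedP (0, 0) st); rewrite path_size; lia.
    have d1 : det (pt t i.*2) (pt t i.*2.+1) = 1 by apply: path_det1; lia.
    have /(_ _ _)/negPf ng := det1_ndvd d1 _ _ gi.
    by rewrite /edge ng ?orFb => [/andP[]| |]; lia.
  by move=> i ik oi; rewrite -(even_halfK oi); apply: H; rewrite even_halfK.
apply/(sortedP (0, 0)) => i; rewrite path_size => ik.
change (edge g (pt t i) (pt t i.+1)).
rewrite /edge path_det1 //=.
by case oi: (odd i); [rewrite (gt i.+1) ?orbT //= oi|rewrite gt ?oi //; lia].
Qed.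

(* If g >= 4, then 2 x_(2m+1) >= x_(2m) for all m, so that the first coordinates
   x_i never reach 0. *)
Lemma even_dvd_lt4 g : even_dvd g -> (g < 4)%N.
Proof.
move=> gt; rewrite ltnNge; apply/negP => g4.
(* The last second coordinate is 1, so its index cannot be even. *)
have ok : odd k.
  apply/negPn/negP => ek; have := gt k.+2 (ltnSn _).
  rewrite path_last /= negbK => /(_ ek); rewrite dvdz1; lia.
have c4 i : (i < k.+1)%N -> ~~ odd i -> 4 <= det (pt t i) (pt t i.+2).
  move=> ik oi; have c0 : 0 < det (pt t i) (pt t i.+2).
    by apply: path_ccw; lia.
  have := even_dvd_det gt ik oi; rewrite dvdzE => /dvdn_leq; lia.
have H m : (m.*2.+1 < k.+3)%N -> (pt t m.*2).1 <= 2 * (pt t m.*2.+1).1.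
  elim: m => [_|m IH mk].
    by rewrite double0 path_first /=; have := @path_fst_gt0 1%N isT; lia.
  rewrite doubleS in mk *.
  have {}IH := IH (ltnW (ltnW mk)).
  have c1 := c4 m.*2 _ _.
  have := (path_rec (i := m.*2) _).1; have := (path_rec (i := m.*2.+1) _).1.
  have x1 := @path_fst_gt0 m.*2.+1; have x2 := @path_fst_gt0 m.*2.+2.
  have c2 := @path_ccw m.*2.+1 m.*2.+3.
  move/(_ ltac:(lia)) => e2 /(_ ltac:(lia)) e1.
  have {}x1 := x1 ltac:(lia); have {}x2 := x2 ltac:(lia).
  have {}c2 := c2 ltac:(lia). have {}c1 := c1 ltac:(lia) ltac:(lia).
  (* The coefficient at least 4 gives [x_(2m+2) >= 2 x_(2m+1)]; the next one, at least 1, then gives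
     [2 x_(2m+3) >= x_(2m+2)]. *)
  nia.
have := H (k.+1)./2; have -> : (k.+1)./2.*2 = k.+1 by lia.
rewrite path_last mulr0 => /(_ ltac:(lia)).
by have := @path_fst_gt0 k.+1 (ltnSn _); lia.
Qed.

End Path.

(** * From chains to Y-frieze patterns *)

Section Unroll.
Variables (k : nat) (t : seq (int * int)).
Hypothesis t_path : diagonal_path k t.

Definition unroll (i : int) : int * int :=
  let s : int := (-1) ^+ odd `|(i %/ k.+3)%Z| in
  let v := pt t `|(i %% k.+3)%Z| in
  (s * v.1, s * v.2).

Lemma unroll_nat (j : nat) : (j < k.+3)%N -> unroll j = pt t j.
Proof.
move=> jk; rewrite /unroll divz_small ?modz_small //=.
by rewrite !mul1r; case: (pt t j).
Qed.

Lemma unrollD (i : int) : unroll (i + k.+3) = (- (unroll i).1, - (unroll i).2).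
Proof.
rewrite /unroll modzDr divzDr // divzz /=.
have -> : odd `|(i %/ k.+3)%Z + 1| = ~~ odd `|(i %/ k.+3)%Z| by lia.
by case: (odd _); rewrite /= !(mulN1r, mul1r) ?opprK.
Qed.

Definition udet i j := det (unroll i) (unroll j).

Lemma udetDl (i j : int) : udet (i + k.+3) j = - udet i j.
Proof. by rewrite /udet unrollD /det /=; ring. Qed.

Lemma udetDr (i j : int) : udet i (j + k.+3) = - udet i j.
Proof. by rewrite /udet unrollD /det /=; ring. Qed.

Lemma udetC i j : udet i j = - udet j i.
Proof. by rewrite /udet /det; ring. Qed.

Lemma udetD2 (i j q : int) : udet (i + q * k.+3) (j + q * k.+3) = udet i j.
Proof.
elim/int_ind: q => [|q IH|q IH]; first by rewrite !mul0r !addr0.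
  have e x : x + q.+1%:Z * k.+3 = x + q%:Z * k.+3 + k.+3 by lia.
  by rewrite !e udetDl udetDr opprK.
rewrite -IH; have e x : x + - q%:Z * k.+3 = x + - q.+1%:Z * k.+3 + k.+3 by lia.
by rewrite !e udetDl udetDr opprK.
Qed.

(** Determinants are invariant under shifting both indices by a multiple of [k + 3], so the first
    index may be taken in one period. *)
Lemma udet_base (P : int -> int -> Prop) :
  (forall i j q : int, P i j -> P (i + q * k.+3) (j + q * k.+3)) ->
  (forall (i : nat) j, (i < k.+3)%N -> P i j) -> forall i j, P i j.
Proof.
move=> PD P0 i j; pose q := (i %/ k.+3)%Z.
suff: P ((i %% k.+3)%Z + q * k.+3) (j - q * k.+3 + q * k.+3).
  by rewrite addrC -divz_eq subrK.
apply: PD.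
have : 0 <= (i %% k.+3)%Z by apply: modz_ge0.
have := ltz_mod i (isT : k.+3%:Z != 0).
by case: (i %% k.+3)%Z => // r rk _; apply: P0; move: rk; rewrite gtr0_norm.
Qed.

Lemma udet_diag i : udet i i = 0.
Proof. by rewrite /udet /det mulrC subrr. Qed.

Lemma udet_succ (i : int) : udet i (i + 1) = 1.
Proof.
suff : forall i j, j = i + 1 -> udet i j = 1 by move=> ->.
apply: udet_base => [{}i j q IH e|{}i j ik ->].
  by rewrite udetD2 IH //; lia.
have [ik'|ik'] := ltnP i k.+2.
  have -> : i%:Z + 1 = i.+1 by lia.
  by rewrite /udet !unroll_nat // (path_det1 t_path).
(* At the seam the pair is [(0, 1)] and [- (1, 0)]. *)
have -> : i%:Z + 1 = 0%N%:Z + k.+3%:Z by lia.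
have -> : i = k.+2 by lia.
rewrite udetDr /udet !unroll_nat // (path_first t_path) (path_last t_path).
by rewrite /det /=; ring.
Qed.

Lemma udet_gt0 (i j : int) : 0 < j - i < k.+3 -> 0 < udet i j.
Proof.
move: i j; apply: udet_base => [i j q IH e|i j ik ij].
  by rewrite udetD2 IH //; lia.
have [jk|jk] := ltrP j k.+3.
  case: j jk ij => j jk ij; last by lia.
  by rewrite /udet !unroll_nat // (path_ccw t_path) //; lia.
have -> : j = (j - k.+3%:Z) + k.+3%:Z by lia.
rewrite udetDr -udetC.
have : 0 <= j - k.+3%:Z by lia.
case ej: (j - k.+3%:Z) => [m|//] _.
rewrite /udet !unroll_nat //; last by lia.
by rewrite (path_ccw t_path) //; lia.
Qed.

Definition unroll_entry (i j : int) := udet (i - 1) (j + 2) * udet i (j + 1).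

Definition path_array : array k := fun s => unroll_entry (val s).1 (val s).2.

Lemma entry_path (i j : int) : - 3 <= j - i <= k%:Z + 2 ->
  entry path_array i j = unroll_entry i j.
Proof. by move=> ij; rewrite /entry insubT. Qed.

Lemma plucker a b c d :
  det a c * det b d = det a b * det c d + det a d * det b c.
Proof. by rewrite /det; ring. Qed.

(** The Plücker relation with two unit determinants. It makes both sides of the diamond rule
    products of the same four determinants. *)
Lemma unroll_entryE (i j : int) :
  1 + unroll_entry i j = udet (i - 1) (j + 1) * udet i (j + 2).
Proof.
have := plucker (unroll (i - 1)) (unroll i) (unroll (j + 1)) (unroll (j + 2)).
rewrite -!/(udet _ _) => ->.
have := udet_succ (i - 1); rewrite subrK => ->.
have := udet_succ (j + 1); rewrite -addrA => ->.
by rewrite mulr1.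
Qed.

Lemma path_array_YFrieze : YFrieze k path_array.
Proof.
split.
- move=> i; rewrite !entry_path; try lia.
  have i1 : udet (i - 1) i = 1 by have := udet_succ (i - 1); rewrite subrK.
  rewrite /unroll_entry; do !split.
  + by rewrite (_ : i - 3 + 2 = i - 1) ?udet_diag ?mul0r //; lia.
  + by rewrite subrK udet_diag mulr0.
  + rewrite (_ : i + k%:Z + 2 = i - 1 + k.+3%:Z); last by lia.
    by rewrite udetDr udet_diag oppr0 mul0r.
  + rewrite (_ : i + k%:Z + 2 + 1 = i + k.+3%:Z); last by lia.
    by rewrite udetDr udet_diag oppr0 mulr0.
  + rewrite subrK (_ : i - 2 + 1 = i - 1); last by lia.
    by rewrite i1 udetC i1 mulrN1.
  + rewrite (_ : i + k%:Z + 1 + 2 = i + k.+3%:Z); last by lia.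
    rewrite (_ : i + k%:Z + 1 + 1 = i - 1 + k.+3%:Z); last by lia.
    by rewrite !udetDr i1 (udetC i) i1 opprK mulr1.
- move=> i j ij; rewrite entry_path; last by lia.
  by apply: mulr_gt0; apply: udet_gt0; lia.
- move=> i j ij; rewrite !entry_path; try lia.
  rewrite !unroll_entryE /unroll_entry !addrK.
  rewrite (_ : j + 1 + 1 = j + 2); last by lia.
  ring.
Qed.
End Unroll.

Arguments path_array k t : clear implicits.

(** * A pattern is determined by one row *)

Section Uniqueness.
Variables (k : nat) (b b' : array k).

Lemma entry_inj : (forall i j : int, - 3 <= j - i <= k%:Z + 2 ->
  entry b i j = entry b' i j) -> b = b'.
Proof.
move=> bb; apply: funext => s; have := bb (val s).1 (val s).2 (valP s).
by rewrite /entry -surjective_pairing valK.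
Qed.

Hypotheses (bY : YFrieze k b) (bY' : YFrieze k b').

(** The shift by one includes the zeros in columns [i - 1] and [i + k] that flank the positive
    entries. *)
Let agree (i : int) := forall d : nat, (d <= k.+1)%N ->
  entry b i (i + d%:Z - 1) = entry b' i (i + d%:Z - 1).

Let agree_interior (i : int) :
  (forall d : nat, (d < k)%N ->
     entry b i (i + d%:Z) = entry b' i (i + d%:Z)) -> agree i.
Proof.
case: bY bY' => [/(_ i)[[_ b1 bk _] _] _ _] [/(_ i)[[_ b1' bk' _] _] _ _] H.
case=> [_|d]; first by rewrite addr0 b1 b1'.
rewrite ltnS (_ : i + d.+1%:Z - 1 = i + d%:Z); last by lia.
by rewrite leq_eqVlt => /predU1P[->|/H//]; rewrite bk bk'.
Qed.

(** Starting from the zero in column [i], the diamond rule is solved for its lower right entry; the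
    factor cancelled is positive. *)
Let agree_succ (i : int) : agree i -> agree (i + 1).
Proof.
case: (bY) (bY') => [bb bp bd] [bb' bp' bd'] ai.
suff H d : (d <= k)%N ->
    entry b (i + 1) (i + d%:Z) = entry b' (i + 1) (i + d%:Z).
  apply: agree_interior => d dk.
  by rewrite (_ : i + 1 + d%:Z = i + d.+1%:Z); [exact: H|lia].
elim: d => [_|d IH dk].
  case: (bb (i + 1)) (bb' (i + 1)) => [[_ + _ _] _] [[_ + _ _] _].
  by rewrite addrK addr0 => -> ->.
have := ai d.+1 (ltnW dk); have := ai d.+2 dk.
rewrite (_ : i + d.+1%:Z - 1 = i + d%:Z); last by lia.
rewrite (_ : i + d.+2%:Z - 1 = i + d%:Z + 1); last by lia.
rewrite (_ : i + d.+1%:Z = i + d%:Z + 1); last by lia.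
move=> e1 e0; have b0 : 0 < entry b i (i + d%:Z) by apply: bp; lia.
apply: (mulfI (lt0r_neq0 b0)); rewrite bd; last by lia.
by rewrite e0 bd' ?e1 ?IH //; lia.
Qed.

(** The mirror argument: start from the zero in column [i + k] and move left. *)
Let agree_pred (i : int) : agree (i + 1) -> agree i.
Proof.
case: (bY) (bY') => [bb bp bd] [bb' bp' bd'] ai.
suff H e d : (d + e = k)%N ->
    entry b i (i + d%:Z) = entry b' i (i + d%:Z).
  apply: agree_interior => d dk; apply: (H (k - d)%N).
  by rewrite subnKC // ltnW.
elim: e d => [d|e IH d dk].
  rewrite addn0 => ->; case: (bb i) (bb' i) => [[_ _ + _] _] [[_ _ + _] _].
  by move=> -> ->.
have := ai d ltac:(lia); have := ai d.+1 ltac:(lia).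
rewrite (_ : i + 1 + d.+1%:Z - 1 = i + d%:Z + 1); last by lia.
rewrite (_ : i + 1 + d%:Z - 1 = i + d%:Z); last by lia.
have := IH d.+1 ltac:(lia).
rewrite (_ : i + d.+1%:Z = i + d%:Z + 1); last by lia.
move=> e2 e1 e0.
have b0 : 0 < entry b (i + 1) (i + d%:Z + 1) by apply: bp; lia.
apply: (mulIf (lt0r_neq0 b0)); rewrite bd; last by lia.
by rewrite e1 bd' ?e2 ?e0 //; lia.
Qed.

Lemma YFrieze_ray_inj :
  (forall d : nat, (d < k)%N -> entry b 0 d = entry b' 0 d) -> b = b'.
Proof.
move=> H; have a0 : agree 0.
  by apply: agree_interior => d dk; rewrite add0r; exact: H.
have {a0} a i : agree i.
  elim/int_ind: i => // i IH.
    by rewrite (_ : i.+1%:Z = i%:Z + 1); [exact: agree_succ|lia].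
  by apply: agree_pred; rewrite (_ : - i.+1%:Z + 1 = - i%:Z); [|lia].
apply: entry_inj => i j ij.
case: bY bY' => [/(_ i)[[b3 _ _ bk2] [b2 bk1]] _ _].
case=> [/(_ i)[[b3' _ _ bk2'] [b2' bk1']] _ _].
have [->|n3] := eqVneq j (i - 3); first by rewrite b3 b3'.
have [->|n2] := eqVneq j (i - 2); first by rewrite b2 b2'.
have [->|m1] := eqVneq j (i + k%:Z + 1); first by rewrite bk1 bk1'.
have [->|m2] := eqVneq j (i + k%:Z + 2); first by rewrite bk2 bk2'.
have := a i (absz (j - i + 1)).
rewrite (_ : i + _ - 1 = j); first by apply; lia.
lia.
Qed.
End Uniqueness.

(** * From Y-frieze patterns to chains *)

(** Here [v_(-1) = (0, -1)] and [v_0 = (1, 0)], so the two determinants are single coordinates. *)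
Lemma entry_path_ray k t (d : nat) : diagonal_path k t -> (d <= k)%N ->
  entry (path_array k t) 0 d = (pt t d.+2).1 * (pt t d.+1).2.
Proof.
move=> tp dk; rewrite entry_path; last by lia.
have e : udet k t k.+2 (d%:Z + 2) = - udet k t (0 - 1) (d%:Z + 2).
  by rewrite -(udetDl tp); congr (udet k t _ _); lia.
rewrite /unroll_entry -[udet k t (0 - 1) _]opprK -e.
rewrite (_ : d%:Z + 2 = d.+2); last by lia.
rewrite (_ : d%:Z + 1 = d.+1); last by lia.
rewrite /udet -[0]/(Posz 0) !unroll_nat; try lia.
rewrite (path_last tp) (path_first tp).
by rewrite /det /=; ring.
Qed.

Section Surjectivity.
Variables (k : nat) (b : array k).
Hypothesis bY : YFrieze k b.

Lemma entry_ge0 (i j : int) : - 1 <= j - i <= k -> 0 <= entry b i j.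
Proof.
case: bY => bb bp _ ij; case: (bb i) => [[_ b1 bk _] _].
have [->|n1] := eqVneq j (i - 1); first by rewrite b1.
have [->|n2] := eqVneq j (i + k%:Z); first by rewrite bk.
by apply: ltW; apply: bp; lia.
Qed.

Variable c : nat -> rat.
Hypothesis cb : forall i : nat, c i * c i.+1 = 1 + (entry b i i)%:~R.
Local Notation K := (continuant c).

(** The formula and its companion for [1 + b_(i+1,i+l)] go by a joint induction on [l], through the
    diamond rules of both sides; the factor cancelled is positive because the entries are
    nonnegative. *)
Lemma entry_continuant (i l : nat) : (l <= k.+2)%N ->
  (entry b i (i%:Z + l%:Z))%:~R = K i l.+2 * K i.+1 l.
Proof.
case: (bY) => bb _ bd.
suff H : (l <= k.+2)%N -> forall i : nat,
    (entry b i (i%:Z + l%:Z))%:~R = K i l.+2 * K i.+1 l /\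
    1 + (entry b (i%:Z + 1) (i%:Z + l%:Z))%:~R = K i.+1 l * K i.+2 l.
  by move=> lk; case: (H lk i).
elim: l => [_|l IH lk] {}i.
  have := cb i; rewrite addr0 /= addn1 => ccb; split.
    by rewrite mulr1 [c i.+1 * _]mulrC ccb; ring.
  case: (bb (i%:Z + 1)) => [[_ + _ _] _].
  by rewrite addrK => ->; ring.
have {}IH := IH (ltnW lk).
have [e1 e2] := IH i; have [e3 _] := IH i.+1.
have ei : i.+1%:Z = i%:Z + 1 by lia.
have el : i%:Z + l.+1%:Z = i%:Z + l%:Z + 1 by lia.
have eil : i.+1%:Z + l%:Z = i%:Z + l%:Z + 1 by lia.
rewrite eil ei in e3; split; last first.
  by rewrite el e3 continuant_diamond; ring.
have := bd i (i%:Z + l%:Z) ltac:(lia).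
move=> /(congr1 (intr : int -> rat)); rewrite !rmorphM !rmorphD /= rmorph1.
rewrite e1 e2 e3 -el => d.
have nz : K i.+1 l * K i.+2 l != 0.
  rewrite -e2 gt_eqF // ltr_wpDr ?ltr01 // ler0z.
  by apply: entry_ge0; lia.
have : 1 + (entry b i (i%:Z + l.+1%:Z))%:~R = K i l.+2 * K i.+1 l.+2.
  apply: (mulIf nz); rewrite -d; ring.
rewrite (continuant_diamond c i l.+1) => /addrI ->.
by [].
Qed.

Hypothesis c_gt0 : forall i, 0 < c i.

Lemma continuant_gt0 i l : (l <= k.+1)%N -> 0 < K i l.
Proof.
suff H : (l <= k.+1)%N -> forall i, 0 < K i l /\ ((l <= k)%N -> 0 < K i l.+1).
  by move=> lk; case: (H lk i).
elim: l => [_ {}i|l IH lk {}i].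
  by split=> //= _; rewrite ?ltr01.
have [k1 k2] := IH (ltnW lk) i; have [k3 _] := IH (ltnW lk) i.+1.
split=> [|lk']; first exact: k2.
have := entry_continuant i (l := l) ltac:(lia) => /esym e.
rewrite -(pmulr_lgt0 _ k3) e ltr0z; case: (bY) => _ bp _.
by apply: bp; lia.
Qed.

Lemma continuant_eq0 i : K i k.+2 = 0.
Proof.
have := entry_continuant i (l := k) ltac:(lia).
case: (bY) => /(_ i)[[_ _ -> _] _] _ _.
move/esym/eqP; rewrite mulf_eq0 (gt_eqF (continuant_gt0 i.+1 (leqnSn k))).
by rewrite orbF => /eqP.
Qed.

Hypothesis c_int : forall i, (i <= k.+1)%N -> c i \is a Num.int.

Lemma continuant_int i l : (i + l <= k.+2)%N -> K i l \is a Num.int.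
Proof.
suff H : (i + l <= k.+2)%N -> K i l \is a Num.int /\
    ((i + l.+1 <= k.+2)%N -> K i l.+1 \is a Num.int).
  by move=> /H[].
elim: l => [_|l IH ilk].
  by split=> [|ik]; [exact: rpred1|apply: c_int; lia].
have [k1 k2] := IH ltac:(lia); split=> [|ilk']; first exact: k2.
by rewrite continuantSr rpredB // rpredM ?k2 ?c_int //; lia.
Qed.

Local Arguments continuant : simpl never.

(** The solution of [v_(j+1) = c_j v_j - v_(j-1)] with [v_0 = (1, 0)] and [v_1 = (c_0, 1)]; [numq]
    only turns integral rationals into integers. *)
Definition ray_path : seq (int * int) :=
  mkseq (fun j => (numq (K 0 j), if j is j'.+1 then numq (K 1 j') else 0)) k.+3.

Lemma pt_ray_path j : (j < k.+3)%N ->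
  pt ray_path j = (numq (K 0 j), if j is j'.+1 then numq (K 1 j') else 0).
Proof. by move=> jk; rewrite /pt nth_mkseq. Qed.

Lemma ray_path_snd_gt0 j : (0 < j < k.+3)%N -> 0 < (pt ray_path j).2.
Proof.
case: j => // j /= jk; rewrite pt_ray_path //= numq_gt0.
by apply: continuant_gt0; lia.
Qed.

Lemma ray_path_rec j : (j < k.+1)%N ->
  (pt ray_path j).2 + (pt ray_path j.+2).2 =
  numq (c j.+1) * (pt ray_path j.+1).2.
Proof.
move=> jk; rewrite !pt_ray_path //=; try lia.
apply: (@intr_inj rat); rewrite rmorphM rmorphD /=.
case: j jk => [|j] jk; last first.
  rewrite !numqK ?continuant_int ?c_int //; try lia.
  rewrite continuantSr add1n; ring.
by rewrite add0r !numqK ?c_int ?continuant_int // -[K 1 0]/1 mulr1.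
Qed.

Lemma ray_path_det1 j : (j < k.+2)%N ->
  det (pt ray_path j) (pt ray_path j.+1) = 1.
Proof.
move=> jk; rewrite !pt_ray_path //=; try lia.
apply: (@intr_inj rat); rewrite /det rmorphB !rmorphM /=.
case: j jk => [|j] jk; first by rewrite /= mul0r subr0.
rewrite !numqK ?continuant_int //; try lia.
by rewrite (continuant_diamond c 0 j); ring.
Qed.

(** Once [K 0 k.+2] vanishes, the diamond rule says that two positive integers have product 1. *)
Lemma ray_path_last : pt ray_path k.+2 = (0, 1).
Proof.
rewrite pt_ray_path // continuant_eq0; congr (_, _).
have := continuant_diamond c 0 k; rewrite continuant_eq0 mul0r addr0.
have k0 := continuant_gt0 0 (leqnn k.+1).
have k1 := continuant_gt0 1 (leqnn k.+1).
rewrite -[K 0 k.+1]numqK ?continuant_int // -[K 1 k.+1]numqK ?continuant_int //.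
rewrite -rmorphM /= => /(@intr_inj rat _ 1) e.
rewrite -numq_gt0 in k0; rewrite -numq_gt0 in k1.
by move: e k0 k1; rewrite !numq_int; nia.
Qed.

Lemma ray_path_ccw i j : (i < j < k.+3)%N ->
  0 < det (pt ray_path i) (pt ray_path j).
Proof.
elim: j => // j IH /andP[]; rewrite ltnS leq_eqVlt => /predU1P[-> jk|ij jk].
  by rewrite ray_path_det1.
have {}IH := IH ltac:(lia).
have yj : 0 < (pt ray_path j).2 by apply: ray_path_snd_gt0; lia.
have yj1 : 0 < (pt ray_path j.+1).2 by apply: ray_path_snd_gt0; lia.
have yi : 0 <= (pt ray_path i).2.
  case: (posnP i) => [->|i0]; first by rewrite pt_ray_path.
  by apply: ltW; apply: ray_path_snd_gt0; lia.
rewrite -(pmulr_lgt0 _ yj).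
have -> : det (pt ray_path i) (pt ray_path j.+1) * (pt ray_path j).2 =
    det (pt ray_path i) (pt ray_path j) * (pt ray_path j.+1).2
    + det (pt ray_path j) (pt ray_path j.+1) * (pt ray_path i).2.
  by rewrite /det; ring.
by rewrite ray_path_det1 // mul1r ltr_wpDr // mulr_gt0.
Qed.

Lemma ray_path_diagonal : diagonal_path k ray_path.
Proof.
rewrite /diagonal_path size_mkseq eqxx ray_path_last pt_ray_path //.
rewrite !eqxx !andbT.
apply/andP; split.
  apply/(sortedP (0, 0)) => j; rewrite size_mkseq => jk.
  change (edge 1 (pt ray_path j) (pt ray_path j.+1)).
  by rewrite /edge ray_path_det1 // dvd1z.
apply/(pairwiseP (0, 0)) => i j; rewrite !inE size_mkseq => _ jk ij.
by apply: ray_path_ccw; rewrite ij.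
Qed.

Lemma ray_path_array : path_array k ray_path = b.
Proof.
apply: YFrieze_ray_inj => //.
  exact: path_array_YFrieze ray_path_diagonal.
move=> d dk; rewrite entry_path_ray ?ray_path_diagonal ?(ltnW dk) //.
rewrite !pt_ray_path //=; try lia.
apply: (@intr_inj rat); rewrite rmorphM /= !numqK ?continuant_int //; try lia.
by rewrite -entry_continuant ?add0r //; lia.
Qed.

End Surjectivity.

Lemma YFrieze_path (k : nat) (b : array k) : YFrieze k b ->
  exists t, [/\ diagonal_path k t, forall g, even_dvd k t g -> g = 1%N
              & path_array k t = b].
Proof.
move=> bY; pose B (i : nat) : rat := 1 + (entry b i i)%:~R.
have B_gt0 i : 0 < B i.
  by rewrite ltr_wpDr ?ltr01 // ler0z; apply: (entry_ge0 bY); lia.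
pose c := fix c i := if i is j.+1 then B j / c j else 1 : rat.
have c_gt0 i : 0 < c i by elim: i => //= i IH; rewrite divr_gt0.
have cB i : c i * c i.+1 = B i by rewrite /= mulrC divfK // gt_eqF.
have cc p q : (p < q <= k.+1)%N -> odd (p + q) -> c p * c q \is a Num.int.
  move=> /andP[pq qk] opq; have -> : q = (p + ((q - p)./2).*2.+1)%N by lia.
  apply: (@mul_entries_int c k.+2) => [i l lk|]; last by lia.
  by rewrite -(entry_continuant bY cB).
have [c' [c'_gt0 c'E c'_int c'_gcd]] :=
  rescale_int (ltn0Sn k) (erefl : c 0%N = 1) c_gt0 cc.
have c'B i : c' i * c' i.+1 = B i by rewrite c'E.
have tp := ray_path_diagonal bY c'B c'_gt0 c'_int.
exists (ray_path k c'); split=> //; last exact: ray_path_array.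
move=> g gt; apply: c'_gcd => -[//|j] jk oj.
have : (g %| det (pt (ray_path k c') j) (pt (ray_path k c') j.+2))%Z.
  by apply: (even_dvd_det tp gt) => //; lia.
(* The odd-indexed [c'] are determinants of even-indexed vectors, so [g] divides them all. *)
have -> : det (pt (ray_path k c') j) (pt (ray_path k c') j.+2) = numq (c' j.+1).
  have y0 := ray_path_snd_gt0 (j := j.+1) bY c'B c'_gt0 ltac:(lia).
  apply: (mulIf (lt0r_neq0 y0)); rewrite (path_rec tp) //.
  exact: ray_path_rec.
by move=> /dvdzP[m e]; exists m; rewrite -e numqK ?c'_int.
Qed.

(** * Counting *)

(** Equal arrays force the two chains to differ only by a factor [a' / a], acting on first
    coordinates at odd places and inversely on second coordinates at even places. In lowest terms
    its numerator and denominator divide all even-placed second coordinates of one chain or the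
    other, so both are 1. *)
Lemma path_array_inj (k : nat) t t' :
  diagonal_path k t -> diagonal_path k t' ->
  (forall g, even_dvd k t g -> g = 1%N) ->
  (forall g, even_dvd k t' g -> g = 1%N) ->
  path_array k t = path_array k t' -> t = t'.
Proof.
move=> tp tp' gt gt' tt.
have [d1 d1'] := (path_det1 tp, path_det1 tp').
have [x_gt0 x'_gt0] := (path_fst_gt0 tp, path_fst_gt0 tp').
have [y_gt0 y'_gt0] := (path_snd_gt0 tp, path_snd_gt0 tp').
set a := (pt t 1).1; set a' := (pt t' 1).1.
have a0 : 0 < a by apply: x_gt0.
have a'0 : 0 < a' by apply: x'_gt0.
have E d : (d <= k)%N ->
    (pt t d.+2).1 * (pt t d.+1).2 = (pt t' d.+2).1 * (pt t' d.+1).2.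
  by move=> dk; rewrite -(entry_path_ray tp dk) -(entry_path_ray tp' dk) tt.
(* Determinant one adds 1 to the products in [E]. *)
have E' d : (d <= k)%N ->
    (pt t d.+1).1 * (pt t d.+2).2 = (pt t' d.+1).1 * (pt t' d.+2).2.
  move=> dk; have := d1 d.+1 ltac:(lia); have := d1' d.+1 ltac:(lia).
  by have := E d dk; rewrite /det; lia.
pose same j := if odd j
  then a * (pt t' j).1 = a' * (pt t j).1 /\ (pt t j).2 = (pt t' j).2
  else (pt t j).1 = (pt t' j).1 /\ a * (pt t j).2 = a' * (pt t' j).2.
have step j : (j <= k)%N -> same j.+1 -> same j.+2.
  move=> jk; rewrite /same /=; have e := E j jk; have e' := E' j jk.
  have x0 := x_gt0 j.+1 ltac:(lia); have y0 := y_gt0 j.+1 ltac:(lia).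
  have y'0 := y'_gt0 j.+1 ltac:(lia).
  case: (odd j) => -[/= e1 e2]; split.
  - apply: (mulIf (lt0r_neq0 y'0)); rewrite -mulrA -e.
    by rewrite mulrCA e2 mulrCA mulrA.
  - by apply: (mulfI (lt0r_neq0 x0)); rewrite e' e1.
  - by apply: (mulIf (lt0r_neq0 y0)); rewrite e e2.
  - apply: (mulfI (lt0r_neq0 x0)); rewrite mulrCA e' mulrA e1.
    by rewrite mulrCA mulrA.
have same_all j : (j < k.+3)%N -> same j.
  case: j => [_|].
    by rewrite /same /= (path_first tp) (path_first tp') /= !mulr0.
  elim=> [_|j IH jk]; last by apply: step => //; apply: IH; lia.
  rewrite /same /= -/a -/a' mulrC; split=> //.
  have := d1 0%N isT; have := d1' 0%N isT.
  rewrite (path_first tp) (path_first tp') /det /=.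
  by rewrite !mul1r !mul0r !subr0 => -> ->.
have [A eA] : exists A : nat, a = A by exists `|a|%N; lia.
have [A' eA'] : exists A : nat, a' = A by exists `|a'|%N; lia.
pose G := gcdn A A'.
have G0 : (0 < G)%N by rewrite gcdn_gt0; lia.
pose u := (A %/ G)%N; pose u' := (A' %/ G)%N.
have uG : (u * G = A)%N by rewrite divnK // dvdn_gcdl.
have u'G : (u' * G = A')%N by rewrite divnK // dvdn_gcdr.
have co : coprime u u'.
  by rewrite /coprime -(eqn_pmul2r G0) muln_gcdl uG u'G mul1n.
have uy j : (j < k.+3)%N -> ~~ odd j -> u%:Z * (pt t j).2 = u'%:Z * (pt t' j).2.
  move=> jk oj; have := same_all j jk; rewrite /same (negPf oj) => -[_].
  rewrite eA eA' -uG -u'G => e; apply: (@mulfI _ G%:Z); first by lia.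
  by move: e; rewrite !PoszM; lia.
have u1 : u = 1%N.
  apply: gt' => j jk oj; rewrite -(@Gauss_dvdzr _ u'%:Z) //.
  by rewrite -uy // dvdz_mulr.
have u'1 : u' = 1%N.
  apply: gt => j jk oj; rewrite -(@Gauss_dvdzr _ u%:Z) ?uy ?dvdz_mulr //.
  by rewrite /coprimez gcdzC.
have aa : a = a' by rewrite eA eA' -uG -u'G u1 u'1.
apply: (@eq_from_nth _ (0, 0)); rewrite (path_size tp) ?(path_size tp') //.
move=> j jk.
change (pt t j = pt t' j); have := same_all j jk; rewrite /same -aa.
move=> h; have a_neq0 := lt0r_neq0 a0.
have [e1 e2] : (pt t j).1 = (pt t' j).1 /\ (pt t j).2 = (pt t' j).2.
  by case: (odd j) h => -[]; [move/(mulfI a_neq0)|move=> + /(mulfI a_neq0)].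
by rewrite [pt t j]surjective_pairing e1 e2 -surjective_pairing.
Qed.

(** * Dissections of the polygon and Fuss-Catalan numbers *)

Definition dissections (g : int) (p : nat) : seq (seq (int * int)) :=
  refinements (subdivide g) p [:: (1, 0); (0, 1)].

Section Dissections.
Variable g : int.
Hypothesis g123 : [|| g == 1, g == 2 | g == 3].

Lemma root_chain : chain g [:: (1, 0); (0, 1)].
Proof. by rewrite /chain /= /edge dvdz0. Qed.

Lemma dissections_uniq p : uniq (dissections g p).
Proof.
apply: (refinements_uniq (size_subdivide g) (subdivide_chain g123)
  (@subdivide_ccwr g) (@subdivide_ccwl g)).
exact: root_chain.
Qed.

(** With one initial edge and [n = p + 1], the forest count reads [n N = C(q n, n - 1)], and [n C(q
    n, n) = ((q - 1) n + 1) C(q n, n - 1)]. *)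
Lemma size_dissections p :
  (size (dissections g p.+1))%:R = fuss_catalan (cell_arity g) p.+1.
Proof.
have := size_refinements (size_subdivide g) p (s := [:: (1, 0); (0, 1)]) erefl.
rewrite -/(dissections _ _).
have q2 : (2 <= cell_arity g)%N by rewrite /cell_arity; do 2 case: ifP => // _.
move: (cell_arity g) (size _) q2 => [|[|q]] // N _ /=.
rewrite mul1n => eN; rewrite /fuss_catalan.
have := mul_bin_left (q.+2 * p.+1) p.
have -> : (q.+2 * p.+1 - p = q.+1 * p.+1 + 1)%N by lia.
have eM : (q.+2 * p + q.+1 + 1 = q.+2 * p.+1)%N by lia.
rewrite eM in eN; rewrite -eN => e.
have {}e : 'C(q.+2 * p.+1, p.+1) = ((q.+1 * p.+1 + 1) * N)%N.
  apply/eqP; rewrite -(eqn_pmul2l (isT : (0 < p.+1)%N)) e; lia.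
rewrite e natrM natrD natrM.
have -> : q.+2%:R - 1 = q.+1%:R :> rat by rewrite mulrS; ring.
have nz : q.+1%:R * p.+1%:R + 1 != 0 :> rat.
  by rewrite -natrM natr1 pnatr_eq0.
by rewrite mulrA mul1r mulVf // mul1r.
Qed.

Lemma dissections_sound (p : nat) t : t \in dissections g p ->
  [/\ chain g t, size t = ((cell_arity g).-2.+1 * p).+2, pt t 0%N = (1, 0)
    & last (1, 0) t = (0, 1)].
Proof.
case/(refinements_sound (size_subdivide g) (subdivide_chain g123)
  (@subdivide_ccwr g) (@subdivide_ccwl g) root_chain) => t' [-> ct _ lt szt].
by split=> //=; rewrite szt.
Qed.

Lemma dissections_complete (k : nat) t :
  diagonal_path k t -> sorted (edge g) t ->
  exists2 p, t \in dissections g p & k.+1 = ((cell_arity g).-2.+1 * p)%N.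
Proof.
case/and4P=> /andP[_ pt_] /eqP sz /eqP t0 /eqP tk st.
case: t sz t0 tk pt_ st => // u t sz t0 tk pt_ st.
have {}t0 : u = (1, 0) by []; rewrite {u}t0 in sz tk pt_ st *.
have lt : last (1, 0) t = (0, 1).
  by rewrite -tk /pt -[k.+2]/k.+3.-1 -sz nth_last.
have ct : chain g ((1, 0) :: t) by apply/andP.
have sub : {subset [:: (0, 1)] <= t}.
  move=> x; rewrite inE => /eqP->; rewrite -lt.
  by case: (t) sz => // y r _; rewrite /= mem_last.
have [p tp] := refinements_complete (size_subdivide g) (subdivide_chain g123)
  (@subdivide_ccwl g) (subdivide_sub g123) root_chain ct sub lt.
exists p => //; have [_ + _ _] := dissections_sound tp.
by rewrite sz => -[].
Qed.

Lemma mem_dissections (k p : nat) t : k.+1 = ((cell_arity g).-2.+1 * p)%N ->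
  (t \in dissections g p) = diagonal_path k t && sorted (edge g) t.
Proof.
move=> kp; apply/idP/andP => [/dissections_sound[ct sz t0 lt]|[tp st]].
  have st : sorted (edge g) t by case/andP: ct.
  rewrite -kp in sz; split=> //; rewrite /diagonal_path t0 sz !eqxx /=.
  rewrite /pt -[k.+2]/k.+3.-1 (set_nth_default (1, 0)) ?sz // -sz nth_last lt.
  rewrite eqxx andbT.
  case/andP: ct => _ pw; apply/andP; split=> //.
  by apply: sub_sorted st => u v /andP[uv _]; rewrite /edge uv dvd1z.
have [p' tp' kp'] := dissections_complete tp st.
suff -> : p = p' by [].
apply/eqP; rewrite -(eqn_pmul2l (isT : (0 < (cell_arity g).-2.+1)%N)).
by rewrite -kp kp'.
Qed.
End Dissections.

(** Chains alternating modulo [g] are exactly the dissections into cells for [g]; each cell adds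
    [q - 1] vertices, whence the divisibility condition. *)
Lemma dissections_count (g k : nat) : [|| g == 2 | g == 3]%N ->
  count (sorted (edge g)) (dissections 1 k.+1) =
  if ((cell_arity g).-2.+1 %| k.+1)%N
  then size (dissections g (k.+1 %/ (cell_arity g).-2.+1)) else 0%N.
Proof.
move=> g23; have g123 : [|| g%:Z == 1, g%:Z == 2 | g%:Z == 3].
  by case/orP: g23 => /eqP->.
rewrite -size_filter; case: ifPn => gk; last first.
  case e: (seq.filter _ _) => [|t s]; [by []|case/negP: gk].
  have : t \in seq.filter (sorted (edge g)) (dissections 1 k.+1).
    by rewrite e mem_head.
  rewrite mem_filter (@mem_dissections 1 isT k) //; last by rewrite mul1n.
  case/and3P=> st tp _; have [p _ ->] := dissections_complete g123 tp st.
  exact: dvdn_mulr.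
apply/perm_size/uniq_perm.
- by rewrite filter_uniq // dissections_uniq.
- exact: dissections_uniq.
move=> t; rewrite mem_filter (@mem_dissections 1 isT k) ?mul1n //.
rewrite (@mem_dissections g g123 k); last by rewrite mulnC divnK.
rewrite andbC; case: (boolP (diagonal_path k t)) => //=.
by case/and4P=> /andP[-> _].
Qed.

Definition primitive_paths k := [seq t <- dissections 1 k.+1 |
  ~~ sorted (edge 2) t && ~~ sorted (edge 3) t].

Lemma mem_primitive_paths (k : nat) t : t \in primitive_paths k <->
  diagonal_path k t /\ (forall g, even_dvd k t g -> g = 1%N).
Proof.
rewrite mem_filter (@mem_dissections 1 isT k) ?mul1n //.
split=> [/and3P[/andP[n2 n3] tp _]|[tp tg]].
  (* The cases are [g = 0], which contradicts positivity of a second coordinate, then 1, 2, 3 and at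
     least 4. *)
  split=> // -[|[//|[|[|g]]]] gt.
  - have := gt 2%N isT isT; rewrite dvd0z => /eqP y0.
    by have := path_snd_gt0 tp (i := 2) isT; rewrite y0.
  - by case/negP: n2; apply/(even_dvd_sorted tp (g := 2) isT).
  - by case/negP: n3; apply/(even_dvd_sorted tp (g := 3) isT).
  - by have := even_dvd_lt4 tp gt.
have nD g : (1 < g)%N -> ~~ sorted (edge g) t.
  by move=> g1; apply/negP => /(even_dvd_sorted tp g1)/tg e; rewrite e in g1.
by rewrite tp !nD //=; case/and4P: tp => /andP[].
Qed.

(** * Cardinality of the set of patterns *)

Local Open Scope classical_set_scope.
Local Open Scope card_scope.

Lemma YFrieze_card (k : nat) : YFrieze k #= `I_(size (primitive_paths k)).
Proof.
set s := primitive_paths k.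
have us : uniq s by rewrite filter_uniq // dissections_uniq.
pose f i := path_array k (nth [::] s i).
have -> : YFrieze k = f @` `I_(size s).
  apply/seteqP; split=> [b /YFrieze_path[t [tp tg <-]]|b [i /= si <-]].
    have ts : t \in s by apply/mem_primitive_paths.
    by exists (index t s); rewrite /= ?index_mem // /f nth_index.
  apply: path_array_YFrieze.
  by have /mem_primitive_paths[] : nth [::] s i \in s by exact: mem_nth.
apply: inj_card_eq => i j; rewrite !inE /= => si sj fij.
have /mem_primitive_paths[ip ig] : nth [::] s i \in s by exact: mem_nth.
have /mem_primitive_paths[jp jg] : nth [::] s j \in s by exact: mem_nth.
apply/eqP; rewrite -(nth_uniq [::] si sj us).
by rewrite (path_array_inj ip jp ig jg fij).
Qed.

(** The two exceptional families are disjoint: divisibility by 2 and by 3 would give 6, which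
    exceeds the bound. *)
Lemma size_primitive_paths (k : nat) :
  (size (dissections 1 k.+1) = size (primitive_paths k)
   + count (sorted (edge 2)) (dissections 1 k.+1)
   + count (sorted (edge 3)) (dissections 1 k.+1))%N.
Proof.
rewrite size_filter -addnA -count_predUI.
have -> : count (predI (sorted (edge 2)) (sorted (edge 3)))
    (dissections 1 k.+1) = 0%N.
  apply/eqP; rewrite -leqn0 leqNgt -has_count; apply/hasPn => t.
  rewrite (@mem_dissections 1 isT k) ?mul1n // => /andP[tp _].
  apply/negP => /andP[/(even_dvd_sorted tp (g := 2) isT) t2].
  move=> /(even_dvd_sorted tp (g := 3) isT) t3.
  have : even_dvd k t 6.
    move=> i ik oi; have := t2 i ik oi; have := t3 i ik oi; lia.
  by move/(even_dvd_lt4 tp).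
rewrite addn0 -(count_predC (predU (sorted (edge 2)) (sorted (edge 3)))) addnC.
by congr (_ + _)%N; apply: eq_count => t; rewrite /= negb_or.
Qed.

Theorem theoremB (w : int) (w_ge0 : 0 <= w) :
  exists N : nat,
    YFrieze w #= `I_N /\
    [/\ (2 %| w)%Z ->
          N%:R = fuss_catalan 2 `|(w + 1)%R|%N,
        (w = 1 %[mod 4])%Z ->
          N%:R = fuss_catalan 2 `|(w + 1)%R|%N
                 - fuss_catalan 3 `|((w + 1)%R %/ 2)%Z|%N
      & (w = 3 %[mod 4])%Z ->
          N%:R = fuss_catalan 2 `|(w + 1)%R|%N
                 - fuss_catalan 3 `|((w + 1)%R %/ 2)%Z|%N
                 - fuss_catalan 5 `|((w + 1)%R %/ 4)%Z|%N].
Proof.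
case: w w_ge0 => // k _; exists (size (primitive_paths k)).
split; first exact: YFrieze_card.
have -> : `|(k%:Z + 1)%R|%N = k.+1 by lia.
have -> : `|((k%:Z + 1)%R %/ 2)%Z|%N = (k.+1 %/ 2)%N by lia.
have -> : `|((k%:Z + 1)%R %/ 4)%Z|%N = (k.+1 %/ 4)%N by lia.
have total := size_primitive_paths k.
rewrite (dissections_count k (g := 2)) // in total.
rewrite (dissections_count k (g := 3)) // in total.
(* Quadrangles add 2 vertices and hexagons 4, so these families occur only when 2, respectively 4,
   divides [w + 1]. *)
rewrite -[(cell_arity 2%N).-2.+1]/2%N -[(cell_arity 3%N).-2.+1]/4%N in total.
have := @size_dissections 1 isT k.
rewrite total !natrD => <-.
have size23 (g : nat) p : [|| g == 2 | g == 3]%N -> (0 < p)%N ->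
    (size (dissections g p))%:R = fuss_catalan (cell_arity g) p.
  move=> g23; case: p => // p _; apply: size_dissections.
  by move: g23; do 2 case: eqP => [->|_] //.
split=> kw.
- have -> : (2 %| k.+1)%N = false by lia.
  have -> : (4 %| k.+1)%N = false by lia.
  by rewrite !addr0.
- have -> : (2 %| k.+1)%N by lia.
  have -> : (4 %| k.+1)%N = false by lia.
  by rewrite addr0 size23 ?addrK //; lia.
have -> : (2 %| k.+1)%N by lia.
have -> : (4 %| k.+1)%N by lia.
rewrite !size23 //; try lia.
by rewrite addrAC addrK addrK.
Qed.
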